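(* For $N\in\mathbb{N}$, let $\mathcal{R}^1=\mathcal{Q}^1\mathcal{K}^1,\dots,\mathcal{R}^N=\mathcal{Q}^N\mathcal{K}^N$ be RNNs. There exists an RNN $\mathcal{R}=\mathcal{Q}\mathcal{K}$ such that for all $x_1\in\mathbb{R}^{\mathcal{M}_{\mathrm{in}}(\mathcal{R}^1)},\dots,x_N\in\mathbb{R}^{\mathcal{M}_{\mathrm{in}}(\mathcal{R}^N)}$ and all $t\in\mathbb{N}_0$, $$\left(\mathcal{K}\mathcal{D}\begin{pmatrix} x_1 \\ \vdots \\ {x_N} \end{pmatrix}\right)[t]=\begin{pmatrix} (\mathcal{K}^1\mathcal{D}x_1)[t] \\ \vdots \\ (\mathcal{K}^N\mathcal{D}x_N)[t] \end{pmatrix}\quad\text{and}\quad\left(\mathcal{R}\mathcal{D}\begin{pmatrix} x_1 \\ \vdots \\ {x_N} \end{pmatrix}\right)[t]=\begin{pmatrix} (\mathcal{R}^1\mathcal{D}x_1)[t] \\ \vdots \\ (\mathcal{R}^N\mathcal{D}x_N)[t] \end{pmatrix}.$$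
   Context: Notation: $\mathbb{N}=\{1,2,\dots\}$, $\mathbb{N}_0=\mathbb{N}\cup\{0\}$; $(\mathbb{R}^d)^{\mathbb{N}_0}$ is the space of sequences in $\mathbb{R}^d$ indexed by $\mathbb{N}_0$; $\rho(x)=\max(0,x)$, applied componentwise. RNN: An RNN with input dimension $d\in\mathbb{N}$, output dimension $d'\in\mathbb{N}$ and hidden state size $m\in\mathbb{N}$ is given by weights $A_h\in\mathbb{R}^{m\times m}$, $A_x\in\mathbb{R}^{m\times d}$, $A_o\in\mathbb{R}^{d'\times m}$, $b_h\in\mathbb{R}^m$, $b_o\in\mathbb{R}^{d'}$. The hidden state operator $\mathcal{K}:(\mathbb{R}^d)^{\mathbb{N}_0}\to(\mathbb{R}^m)^{\mathbb{N}_0}$ maps an input sequence $(x[t])_{t\in\mathbb{N}_0}$ to $(\mathcal{K}x)[t]=h[t]$, where $h[-1]=0$ and $h[t]=\rho(A_hh[t-1]+A_xx[t]+b_h)$ for $t\in\mathbb{N}_0$. The output mapping is $\mathcal{Q}(h)=A_oh+b_o$. The associated RNN is $\mathcal{R}=\mathcal{Q}\mathcal{K}$, $(\mathcal{R}x)[t]=\mathcal{Q}((\mathcal{K}x)[t])$. Write $\mathcal{M}_{\mathrm{in}}(\mathcal{R})=d$. The operator $\mathcal{D}:\mathbb{R}^d\to(\mathbb{R}^d)^{\mathbb{N}_0}$ is defined by $(\mathcal{D}x)[0]=x$ and $(\mathcal{D}x)[t]=0$ for $t\ge1$. *)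

(* Defs.v *)
From mathcomp Require Import all_boot all_order all_algebra.
From mathcomp Require Import reals.

Set Implicit Arguments.
Unset Strict Implicit.
Unset Printing Implicit Defensive.

Import Order.TTheory GRing.Theory Num.Theory.
Local Open Scope ring_scope.

Definition relu (R : realType) (n : nat) (v : 'cV[R]_n) : 'cV[R]_n :=
  map_mx (Num.max 0) v.

(* The dimensions are parameters rather than fields, so that equations between
   block vectors typecheck without casts. *)
Record rnn (R : realType) (d m d' : nat) := RNN {
  rnn_in_gt0 : (0 < d)%N;
  rnn_hid_gt0 : (0 < m)%N;
  rnn_out_gt0 : (0 < d')%N;
  rnn_Ah : 'M[R]_(m, m);
  rnn_Ax : 'M[R]_(m, d);
  rnn_Ao : 'M[R]_(d', m);
  rnn_bh : 'cV[R]_m;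
  rnn_bo : 'cV[R]_d'
}.

Definition rnn_step (R : realType) (d m d' : nat) (S : rnn R d m d')
    (h : 'cV[R]_m) (x : 'cV[R]_d) : 'cV[R]_m :=
  relu (rnn_Ah S *m h + rnn_Ax S *m x + rnn_bh S).

(* The hidden state operator K, with [rnn_hidden S x t] = h[t]; the initial state
   h[-1] = 0 has no natural-number index, so it is the literal 0 below. *)
Fixpoint rnn_hidden (R : realType) (d m d' : nat) (S : rnn R d m d')
    (x : nat -> 'cV[R]_d) (t : nat) {struct t} : 'cV[R]_m :=
  match t with
  | 0%N => rnn_step S 0 (x 0%N)
  | s.+1 => rnn_step S (rnn_hidden S x s) (x s.+1)
  end.

Definition rnn_readout (R : realType) (d m d' : nat) (S : rnn R d m d')
    (h : 'cV[R]_m) : 'cV[R]_d' :=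
  rnn_Ao S *m h + rnn_bo S.

Definition rnn_run (R : realType) (d m d' : nat) (S : rnn R d m d')
    (x : nat -> 'cV[R]_d) (t : nat) : 'cV[R]_d' :=
  rnn_readout S (rnn_hidden S x t).

Definition impulse (R : realType) (d : nat) (x : 'cV[R]_d) (t : nat) :
    'cV[R]_d :=
  if t is 0%N then x else 0.

(* Main.v *)
Require Import Defs.
From mathcomp Require Import all_boot all_order all_algebra.
From mathcomp Require Import reals.

Set Implicit Arguments.
Unset Strict Implicit.
Unset Printing Implicit Defensive.

Import Order.TTheory GRing.Theory Num.Theory.
Local Open Scope ring_scope.

(** The networks run side by side without interacting: take block-diagonal weights and stacked
    biases. Since [relu] acts componentwise, it commutes with stacking, so a step of the big network
    is the stack of the single steps ([rnn_step_parallel]). Induction on time extends this to hidden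
    states, for any stacked inputs, and the affine readout respects blocks too. It remains to see
    that [impulse] commutes with stacking. *)

(* [mxdiag] only covers square blocks; writing block row [i] as [B i] times the
   coordinate projection onto block [i] of [1%:M] handles rectangular ones
   without casts. *)
Definition rect_mxdiag (R : pzSemiRingType) (N : nat) (p q : 'I_N -> nat)
    (B : forall i, 'M[R]_(p i, q i)) : 'M[R]_(\sum_i p i, \sum_i q i) :=
  \mxcol_i (B i *m submxcol 1%:M i).

(** Block row [i] of the identity, applied to a stack, picks out its component [i]. *)
Lemma rect_mxdiag_mul (R : pzSemiRingType) (N k : nat) (p q : 'I_N -> nat)
    (B : forall i, 'M[R]_(p i, q i)) (v : forall i, 'M[R]_(q i, k)) :
  rect_mxdiag B *m (\mxcol_i v i) = \mxcol_i (B i *m v i).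
Proof.
rewrite mxcol_mul; apply: eq_mxcol => i.
by rewrite -mulmxA submxcol_mul mul1mx mxcolK.
Qed.

Lemma map_mxcol (aT rT : Type) (f : aT -> rT) (N n : nat) (p : 'I_N -> nat)
    (v : forall i, 'M[aT]_(p i, n)) :
  map_mx f (\mxcol_i v i) = \mxcol_i map_mx f (v i).
Proof. by apply/matrixP => a b; rewrite !mxE. Qed.

Lemma sumn_ord_gt0 (N : nat) (F : 'I_N -> nat) :
  (0 < N)%N -> (forall i, 0 < F i)%N -> (0 < \sum_(i < N) F i)%N.
Proof.
move=> N_gt0 F_gt0; rewrite (bigD1 (Ordinal N_gt0)) //=.
by rewrite ltn_addr.
Qed.

Section Parallel.
Variables (R : realType) (N : nat) (N_gt0 : (0 < N)%N) (d m d' : 'I_N -> nat).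
Variable S : forall i : 'I_N, rnn R (d i) (m i) (d' i).

Definition rnn_parallel :
    rnn R (\sum_(i < N) d i) (\sum_(i < N) m i) (\sum_(i < N) d' i) :=
  RNN (sumn_ord_gt0 N_gt0 (fun i => rnn_in_gt0 (S i)))
    (sumn_ord_gt0 N_gt0 (fun i => rnn_hid_gt0 (S i)))
    (sumn_ord_gt0 N_gt0 (fun i => rnn_out_gt0 (S i)))
    (rect_mxdiag (fun i => rnn_Ah (S i))) (rect_mxdiag (fun i => rnn_Ax (S i)))
    (rect_mxdiag (fun i => rnn_Ao (S i)))
    (\mxcol_i rnn_bh (S i)) (\mxcol_i rnn_bo (S i)).

Lemma rnn_step_parallel (h : forall i, 'cV[R]_(m i)) (x : forall i, 'cV[R]_(d i)) :
  rnn_step rnn_parallel (\mxcol_i h i) (\mxcol_i x i)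
    = \mxcol_i rnn_step (S i) (h i) (x i).
Proof. by rewrite /rnn_step /relu /= !rect_mxdiag_mul -!mxcolD map_mxcol. Qed.

Lemma rnn_hidden_parallel (x : forall i, nat -> 'cV[R]_(d i)) (t : nat) :
  rnn_hidden rnn_parallel (fun s => \mxcol_i x i s) t
    = \mxcol_i rnn_hidden (S i) (x i) t.
Proof.
elim: t => [|t IH] /=; last by rewrite IH rnn_step_parallel.
(* The zero initial state is the stack of the zero initial states, so the first step is also a
   parallel step. *)
by rewrite -rnn_step_parallel mxcol0.
Qed.

Lemma rnn_readout_parallel (h : forall i, 'cV[R]_(m i)) :
  rnn_readout rnn_parallel (\mxcol_i h i) = \mxcol_i rnn_readout (S i) (h i).
Proof. by rewrite /rnn_readout /= rect_mxdiag_mul -mxcolD. Qed.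

End Parallel.

Lemma impulse_mxcol (R : realType) (N : nat) (d : 'I_N -> nat)
    (x : forall i, 'cV[R]_(d i)) (t : nat) :
  impulse (\mxcol_i x i) t = \mxcol_i impulse (x i) t.
Proof. by case: t => [|t] //=; rewrite mxcol0. Qed.

(** Needed because [impulse_mxcol] identifies the two input sequences only pointwise, not as
    functions. *)
Lemma eq_rnn_hidden (R : realType) (d m d' : nat) (S : rnn R d m d')
    (x y : nat -> 'cV[R]_d) : x =1 y -> rnn_hidden S x =1 rnn_hidden S y.
Proof. by move=> xy; elim=> [|t IH] /=; rewrite ?IH xy. Qed.

Theorem mainTheorem4 (R : realType) (N : nat) (hN : (0 < N)%N)
    (d m d' : 'I_N -> nat) (S : forall i : 'I_N, rnn R (d i) (m i) (d' i)) :
  exists T : rnn R (\sum_(i < N) d i)%N (\sum_(i < N) m i)%N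
                   (\sum_(i < N) d' i)%N,
    forall (x : forall i : 'I_N, 'cV[R]_(d i)) (t : nat),
      rnn_hidden T (impulse (\mxcol_(i < N) x i)) t
        = \mxcol_(i < N) rnn_hidden (S i) (impulse (x i)) t
      /\ rnn_run T (impulse (\mxcol_(i < N) x i)) t
        = \mxcol_(i < N) rnn_run (S i) (impulse (x i)) t.
Proof.
exists (rnn_parallel hN S) => x t.
have hidE : rnn_hidden (rnn_parallel hN S) (impulse (\mxcol_i x i)) t
    = \mxcol_i rnn_hidden (S i) (impulse (x i)) t.
  by rewrite -rnn_hidden_parallel; apply/eq_rnn_hidden/impulse_mxcol.
by split=> //; rewrite /rnn_run hidE rnn_readout_parallel.
Qed.
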